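(* Let $u=(u_i)_{i\in I}$ and $v=(v_i)_{i\in I}$ be positive weights on an index set $I\neq\emptyset$ and let $p,q\in(0,\infty]$. Then the map $$\iota:\left(\ell_0(I),\|\cdot\|_{\ell_v^p}\right)\hookrightarrow\ell_u^q(I),\quad(c_i)_{i\in I}\mapsto(c_i)_{i\in I}$$ is bounded if and only if $$(u_i/v_i)_{i\in I}\in\ell^{q\cdot(p/q)'}(I).$$ Here the exponent $q\cdot(p/q)'$ is to be understood as $\infty$ if $q=\infty$, and as $q\cdot(p/q)'$ if $q<\infty$. If this condition is fulfilled, one even has $\ell_v^p(I)\hookrightarrow\ell_u^q(I)$.
   Context: For a weight $u=(u_i)_{i\in I}$ with $u_i>0$, $\ell_u^q(I)=\{x\in\mathbb{C}^I:(u_ix_i)_{i\in I}\in\ell^q(I)\}$ with $\|x\|_{\ell_u^q}=\|(u_ix_i)_{i\in I}\|_{\ell^q}$. $\ell_0(I)$ is the space of finitely supported complex sequences on $I$. $X\hookrightarrow Z$ means $X\subset Z$ with $\|x\|_Z\leq C\|x\|_X$ for all $x\in X$. Conjugate exponents: for $r\in[1,\infty]$, $\frac1r+\frac1{r'}=1$ (so $1'=\infty$, $\infty'=1$), and $r'=\infty$ for $r\in(0,1)$. Further conventions: $p/q=\infty$ if $p=\infty$ and $q<\infty$; $q\cdot\infty=\infty$. *)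

(* Defs.v *)
From mathcomp Require Import all_boot all_order all_algebra.
From mathcomp Require Import all_classical all_reals all_analysis.
From mathcomp Require Import complex.

Set Implicit Arguments.
Unset Strict Implicit.
Unset Printing Implicit Defensive.

Import Order.TTheory GRing.Theory Num.Theory.

Local Open Scope classical_set_scope.
Local Open Scope complex_scope.
Local Open Scope ring_scope.
Local Open Scope ereal_scope.

Section sequence_spaces.
Context {R : realType} {I : choiceType}.
Implicit Types (p : \bar R) (w : I -> R) (x : I -> R[i]).

(* Meaningful for 0 < p <= +oo and I nonempty: over an empty I, the supremum
   below is -oo. *)
Definition lnorm p x : \bar R :=
  match p with
  | r%:E => (\esum_(i in [set: I]) (ComplexField.Normc.normc (x i) `^ r)%:E)
              `^ r^-1
  | +oo => ereal_sup (range (fun i => (ComplexField.Normc.normc (x i))%:E))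
  | -oo => 0
  end.

Definition lspace p : set (I -> R[i]) := [set x | lnorm p x < +oo].

Definition weight w x : I -> R[i] := fun i => ((w i)%:C * x i)%R.

Definition wlnorm w p x : \bar R := lnorm p (weight w x).

Definition wlspace w p : set (I -> R[i]) := [set x | lspace p (weight w x)].

Definition l0space : set (I -> R[i]) := [set x | finite_set [set i | x i != 0%R]].

End sequence_spaces.

(* A map f from the space X with quasi-norm nX to the space Z with quasi-norm
   nZ, all given inside ambient types; the quasi-norms are extended-real valued
   and finite on X and Z respectively. *)
Definition bounded_map {R : realType} {V W : Type} (X : set V) (nX : V -> \bar R)
    (Z : set W) (nZ : W -> \bar R) (f : V -> W) : Prop :=
  (forall x, X x -> Z (f x)) /\
  exists2 C : R, (0 <= C)%R & forall x, X x -> nZ (f x) <= C%:E * nX x.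

Definition embeds {R : realType} {V : Type} (X : set V) (nX : V -> \bar R)
    (Z : set V) (nZ : V -> \bar R) : Prop :=
  X `<=` Z /\
  exists2 C : R, (0 <= C)%R & forall x, X x -> nZ x <= C%:E * nX x.

(* hoelder_conjugate r is negative for 0 < r < 1, whereas here r' = +oo. *)
Definition conj_exp {R : realType} (r : \bar R) : \bar R :=
  if r < 1 then +oo else hoelder_conjugate r.

(* For q < +oo, the conventions p / q = +oo if p = +oo, and q * +oo = +oo, are
   those of the extended-real operations. *)
Definition embedding_exp {R : realType} (p q : \bar R) : \bar R :=
  if q == +oo then +oo else q * conj_exp (p / q).

(* Main.v *)
(* Put w = u / v. Substituting y = v x, the embedding says that multiplication
   by w maps l^p boundedly to l^q, and by homogeneity it suffices to bound it
   on the unit ball of l^p. If p <= q, the entries of a point x of the unit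
   ball are at most 1, so |x|^q <= |x|^p and sup w is a bound; if q < p = oo,
   the norm of w in l^q is one. If q < p < oo and 1 / t = 1 / q - 1 / p, Young's
   inequality gives |w x|^q <= w^t + |x|^p entrywise, which is summable.
   Conversely, unit vectors show w <= C if p <= q, indicators of finite sets J
   bound the l^q norm of w if p = oo, and for q < p < oo the test sequences
   w^(t/p) on J turn the estimate into S^(1/q) <= C S^(1/p) with S the sum of
   w^t over J, that is S <= C^t. *)
Require Import Defs.
From mathcomp Require Import all_boot all_order all_algebra.
From mathcomp Require Import all_classical all_reals all_analysis.
From mathcomp Require Import complex.
From mathcomp Require Import ring lra.

Import Order.TTheory GRing.Theory Num.Theory.

Local Open Scope classical_set_scope.
Local Open Scope complex_scope.
Local Open Scope ring_scope.

Local Notation normc := ComplexField.Normc.normc.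

(** * Moduli, finite sums and real powers *)

Lemma normc_ge0 (R : rcfType) (z : R[i]) : 0 <= normc z.
Proof. by case: z => a b; exact: sqrtr_ge0. Qed.

Lemma normc_real (R : rcfType) (a : R) : 0 <= a -> normc a%:C = a.
Proof. by move=> a0; rewrite /= expr0n addr0 sqrtr_sqr ger0_norm. Qed.

Lemma ler_fsum (R : realDomainType) (I : choiceType) (J : set I) (f g : I -> R) :
  finite_set J -> (forall i, J i -> f i <= g i) ->
  \sum_(i \in J) f i <= \sum_(i \in J) g i.
Proof.
move=> finJ fg; rewrite -lee_fin -!fsumEFin//.
by apply: lee_fsum => // i Ji; rewrite lee_fin fg.
Qed.

Lemma ler_fsum_subset (R : realDomainType) (I : choiceType) (J K : set I)
    (f : I -> R) :
  finite_set K -> J `<=` K -> (forall i, 0 <= f i) ->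
  \sum_(i \in J) f i <= \sum_(i \in K) f i.
Proof.
move=> finK JK f0; have finJ := sub_finite_set JK finK.
rewrite -lee_fin -!fsumEFin//; apply: lee_fsum_nneg_subset => //.
- by move=> i; rewrite !inE => /JK.
- by move=> i _; rewrite lee_fin.
Qed.

Lemma powRVK (R : realType) (a s : R) : 0 <= a -> s != 0 -> (a `^ s^-1) `^ s = a.
Proof. by move=> a0 s0; rewrite -powRrM mulVf// powRr1. Qed.

Lemma powRKV (R : realType) (a s : R) : 0 <= a -> s != 0 -> (a `^ s) `^ s^-1 = a.
Proof. by move=> a0 s0; rewrite -powRrM mulfV// powRr1. Qed.

(** Young's inequality; the factors [a^-1] and [b^-1] are at most 1 and are dropped, since only
    boundedness matters later. *)
Lemma ler_mul_powRD (R : realType) (x y a b : R) : 0 <= x -> 0 <= y ->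
  1 < a -> 1 < b -> a^-1 + b^-1 = 1 -> x * y <= x `^ a + y `^ b.
Proof.
move=> x0 y0 a1 b1 ab.
have a0 : 0 < a by lra.
have b0 : 0 < b by lra.
apply: le_trans (conjugate_powR x0 y0 a0 b0 ab) _.
by apply: lerD; rewrite ler_piMr ?powR_ge0// invf_le1// ltW.
Qed.

(** * Bounds on the quasi-norm and its homogeneity *)

Section lnorm.
Context {R : realType} {I : choiceType}.
Implicit Types (x : I -> R[i]) (w : I -> R) (p q : \bar R).

(** Powers are monotone, so the outer root moves to the other side, and a sum of nonnegative terms
    is the supremum of its finite partial sums. Norm estimates thus become estimates of finite real
    sums. *)
Lemma lnorm_leP (s C : R) x : 0 < s -> 0 <= C ->
  (lnorm s%:E x <= C%:E)%E <->
  forall J, finite_set J -> \sum_(i \in J) normc (x i) `^ s <= C `^ s.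
Proof.
move=> s0 C0; have sN0 : s != 0 by rewrite gt_eqF.
have e0 : (0 <= \esum_(i in [set: I]) (normc (x i) `^ s)%:E)%E.
  by apply: esum_ge0 => i _; rewrite lee_fin powR_ge0.
have -> : (lnorm s%:E x <= C%:E)%E =
    (\esum_(i in [set: I]) (normc (x i) `^ s)%:E <= (C `^ s)%:E)%E.
  rewrite /lnorm; case: (esum _ _) e0 => [r| |]// r0.
  - rewrite poweR_EFin !lee_fin; apply/idP/idP => h.
    + rewrite -(powRVK _ r s)//; apply: ge0_ler_powR => //;
        by rewrite ?nnegrE ?powR_ge0// ltW.
    + rewrite -(powRKV _ C s)//; apply: ge0_ler_powR => //;
        by rewrite ?nnegrE ?invr_ge0 ?powR_ge0// ltW.
  (* The root of an infinite sum is infinite because its exponent is nonzero, so both inequalities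
     fail. *)
  - by rewrite poweRyr ?invr_eq0.
split=> [h J finJ|h].
- rewrite -lee_fin -fsumEFin//; apply: le_trans h.
  by apply: esum_ge; exists J.
- apply: ge_ereal_sup => _ [J [finJ _] <-].
  by rewrite fsumEFin// lee_fin h.
Qed.

Lemma lnormy_leP (C : R) x :
  (lnorm +oo x <= C%:E)%E <-> forall i, normc (x i) <= C.
Proof.
split=> [h i|h].
- by rewrite -lee_fin; apply: le_trans h; apply: ereal_sup_ubound; exists i.
- by apply: ge_ereal_sup => _ [i _ <-]; rewrite lee_fin.
Qed.

Lemma normc_le_lnorm p (C : R) x i : (0 < p)%E -> 0 <= C ->
  (lnorm p x <= C%:E)%E -> normc (x i) <= C.
Proof.
case: p => [s| |]// s0 C0; last by move/lnormy_leP.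
rewrite lte_fin in s0.
move/(lnorm_leP s C x s0 C0)/(_ [set i] (finite_set1 i)); rewrite fsbig_set1.
by rewrite leNgt => h; rewrite leNgt; apply: contra h => h;
  apply: gt0_ltr_powR => //; rewrite nnegrE ?normc_ge0.
Qed.

(** The case [c = 0] is included because it serves below for sequences of norm zero. *)
Lemma lnorm_scale_le p (c D : R) x : (0 < p)%E -> 0 <= c -> 0 <= D ->
  (lnorm p x <= D%:E)%E -> (lnorm p (fun i => (c%:C * x i)%R) <= (c * D)%:E)%E.
Proof.
move=> p0 c0 D0; have N i : normc (c%:C * x i) = c * normc (x i).
  by rewrite ComplexField.Normc.normcM normc_real.
case: p p0 => [s| |]// s0.
- rewrite lte_fin in s0; move/(lnorm_leP s D x s0 D0) => h.
  apply/lnorm_leP => //; first exact: mulr_ge0.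
  move=> J finJ; rewrite powRM//.
  under eq_fsbigr do rewrite N powRM ?normc_ge0//.
  by rewrite -mulr_fsumr// ler_wpM2l ?powR_ge0// h.
- by move/lnormy_leP => h; apply/lnormy_leP => i; rewrite N ler_wpM2l.
Qed.

Context (I_neq0 : [set: I] !=set0).

(** For [p = +oo] an index must exist: an empty supremum would be [-oo]. *)
Lemma lnorm_ge0 p x : (0 < p)%E -> (0 <= lnorm p x)%E.
Proof.
case: p => [s| |]// s0; first exact: poweR_ge0.
have [i _] := I_neq0; apply: (@le_trans _ _ (normc (x i))%:E).
  by rewrite lee_fin normc_ge0.
by apply: ereal_sup_ubound; exists i.
Qed.

Lemma lspaceP p x : (0 < p)%E ->
  lspace p x <-> exists2 C : R, 0 <= C & (lnorm p x <= C%:E)%E.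
Proof.
move=> p0; rewrite /lspace /=; split=> [h|[C _ h]].
- have fx : lnorm p x \is a fin_num by rewrite ge0_fin_numE// lnorm_ge0.
  exists (fine (lnorm p x)); first by rewrite fine_ge0// lnorm_ge0.
  by rewrite fineK.
- by apply: le_lt_trans h _; rewrite ltry.
Qed.

Lemma lnorm_homogeneous_bound p q (C : R) w : (0 < p)%E -> (0 < q)%E ->
  (forall i, 0 < w i) -> 0 <= C ->
  (forall x, (lnorm p x <= 1)%E -> (lnorm q (weight w x) <= C%:E)%E) ->
  forall x, lspace p x -> (lnorm q (weight w x) <= C%:E * lnorm p x)%E.
Proof.
move=> p0 q0 w0 C0 H x xp.
have fx : lnorm p x \is a fin_num by rewrite ge0_fin_numE// lnorm_ge0.
have t0 : 0 <= fine (lnorm p x) by rewrite fine_ge0// lnorm_ge0.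
(* A real [t] replaces the norm, with [lnorm p x <= t] and [0 <= t] retained. *)
rewrite -(fineK fx) -EFinM; have xt := lexx (lnorm p x); move: xt t0.
rewrite -{2}(fineK fx); move: (fine _) => t xt.
rewrite le_eqVlt => /predU1P[t0|t0].
(* Norm zero admits no rescaling, but forces [x = 0]; the image is written as 0 times itself, so
   that scaling gives the bound 0. *)
- subst t; have x0 i : x i = 0.
    apply: ComplexField.Normc.eq0_normc; apply/eqP.
    by rewrite eq_le normc_ge0 andbT (normc_le_lnorm p 0 x).
  have -> : weight w x = fun i => 0%:C * weight w x i.
    by apply/funext => i; rewrite /weight x0 !mulr0.
  rewrite mulrC; apply: lnorm_scale_le => //; apply: H.
  by apply: le_trans xt _; rewrite lee_fin.
- have -> : weight w x = fun i => t%:C * weight w (fun i => t^-1%:C * x i) i.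
    apply/funext => i; rewrite /weight mulrCA [t%:C * _]mulrA -rmorphM/=.
    by rewrite mulfV ?gt_eqF// mul1r.
  rewrite mulrC; apply: lnorm_scale_le => //; first exact: ltW.
  apply: H; have := lnorm_scale_le p t^-1 t x p0.
  rewrite mulVf ?gt_eqF// invr_ge0 => -> //; exact: ltW.
Qed.

End lnorm.

(** * Unit-ball bounds for multiplication by a weight *)

Section multiplier.
Context {R : realType} {I : choiceType}.
Implicit Types (x : I -> R[i]) (w : I -> R) (p q : \bar R).

Lemma normc_weight w x i : 0 < w i -> normc (weight w x i) = w i * normc (x i).
Proof.
by move=> wi; rewrite /weight ComplexField.Normc.normcM normc_real ?ltW.
Qed.

Lemma unit_ball_bound_le p q (C : R) w x : (0 < p)%E -> (p <= q)%E ->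
  (forall i, 0 < w i) -> 0 <= C -> (forall i, w i <= C) ->
  (lnorm p x <= 1)%E -> (lnorm q (weight w x) <= C%:E)%E.
Proof.
move=> p0 pq w0 C0 wC xp.
have w_ge0 i : 0 <= w i by exact: ltW.
have x1 i : normc (x i) <= 1 by apply: (normc_le_lnorm p).
case: q pq => [s| |] pq; last first.
- by case: p p0 pq {xp}.
- apply/lnormy_leP => i; rewrite normc_weight// -[C]mulr1.
  by rewrite ler_pM// normc_ge0.
case: p p0 pq xp => [r| |]//; rewrite lte_fin lee_fin => r0 rs.
move/(lnorm_leP r 1 x r0 ler01) => xr.
have s0 := lt_le_trans r0 rs.
apply/lnorm_leP => // J finJ.
apply: (@le_trans _ _ (\sum_(i \in J) C `^ s * normc (x i) `^ r)).
  apply: ler_fsum => // i _.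
  rewrite normc_weight// powRM ?normc_ge0//.
  apply: ler_pM; rewrite ?powR_ge0//.
    by apply: ge0_ler_powR; rewrite ?nnegrE// ltW.
  (* Monotonicity in the exponent is applied on (0, 1]; at 0 both powers vanish. *)
  have := normc_ge0 _ (x i); rewrite le_eqVlt => /predU1P[<-|xi].
    by rewrite !powR0 ?gt_eqF.
  by apply: ger_powR => //; rewrite xi x1.
rewrite -mulr_fsumr// ler_piMr ?powR_ge0//.
by apply: le_trans (xr J finJ) _; rewrite powR1.
Qed.

Lemma unit_ball_bound_y (s C : R) w x : 0 < s ->
  (forall i, 0 < w i) -> 0 <= C ->
  (lnorm s%:E (fun i => (w i)%:C) <= C%:E)%E ->
  (lnorm +oo x <= 1)%E -> (lnorm s%:E (weight w x) <= C%:E)%E.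
Proof.
move=> s0 w0 C0 /(lnorm_leP s C _ s0 C0) wC /lnormy_leP x1.
have w_ge0 i : 0 <= w i by exact: ltW.
apply/lnorm_leP => // J finJ; apply: le_trans (wC J finJ).
apply: ler_fsum => // i _; apply: (ge0_ler_powR (ltW s0));
  rewrite ?nnegrE ?normc_ge0//.
by rewrite normc_weight// normc_real// ler_piMr// ltW.
Qed.

(** Young's inequality is applied to [w^s] and [|x|^s] with the conjugate exponents [r / (r - s)]
    and [r / s]; summing the resulting powers gives at most [C^t + 1], where [t = r s / (r - s)]. *)
Lemma unit_ball_bound_lt (r s C : R) w x : 0 < s -> s < r ->
  (forall i, 0 < w i) -> 0 <= C ->
  (lnorm (r * s / (r - s))%:E (fun i => (w i)%:C) <= C%:E)%E ->
  (lnorm r%:E x <= 1)%E ->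
  (lnorm s%:E (weight w x) <= ((C `^ (r * s / (r - s)) + 1) `^ s^-1)%:E)%E.
Proof.
move=> s0 sr w0 C0 wC; have r0 := lt_trans s0 sr.
have w_ge0 i : 0 <= w i by exact: ltW.
have rs0 : 0 < r - s by rewrite subr_gt0.
have t0 : 0 < r * s / (r - s) by rewrite divr_gt0 ?mulr_gt0.
move/(lnorm_leP r 1 _ r0 ler01) => xr.
move: wC => /(lnorm_leP _ C _ t0 C0) wC.
apply/lnorm_leP; rewrite ?powR_ge0// => J finJ.
rewrite powRVK ?gt_eqF ?addr_ge0 ?powR_ge0//.
have := lerD (wC J finJ) (xr J finJ); rewrite powR1; apply: le_trans.
rewrite -fsbig_split//; apply: ler_fsum => // i _.
rewrite normc_weight// normc_real// powRM ?normc_ge0//.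
have -> : w i `^ (r * s / (r - s)) = (w i `^ s) `^ (r / (r - s)).
  by rewrite -powRrM mulrA [s * r]mulrC.
have -> : normc (x i) `^ r = (normc (x i) `^ s) `^ (r / s).
  by rewrite -powRrM mulrCA mulfV ?gt_eqF// mulr1.
apply: ler_mul_powRD; rewrite ?powR_ge0//.
- by rewrite ltr_pdivlMr// mul1r gtrBl.
- by rewrite ltr_pdivlMr// mul1r.
- by rewrite !invf_div -mulrDl subrK mulfV ?gt_eqF.
Qed.

(** * Values of the embedding exponent *)

Lemma embedding_exp_le p q : (0 < p)%E -> (p <= q)%E -> embedding_exp p q = +oo%E.
Proof.
rewrite /embedding_exp; case: eqP => // /eqP qy p0 pq.
have q0 := lt_le_trans p0 pq.
case: q qy q0 pq => [s| |]//= _; rewrite lte_fin => s0.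
case: p p0 => [r| |]//; rewrite lte_fin lee_fin => r0 rs.
rewrite inver gt_eqF// -EFinM /conj_exp lte_fin; case: ltP => h.
  by rewrite gt0_muley// lte_fin.
(* Since [r <= s], only the borderline ratio 1 remains, and [1' = +oo]. *)
have -> : r / s = 1.
  by apply/eqP; rewrite eq_le h andbT ler_pdivrMr// mul1r.
by rewrite hoelder_conjugate1 gt0_muley// lte_fin.
Qed.

Lemma embedding_exp_y (s : R) : 0 < s -> embedding_exp +oo s%:E = s%:E.
Proof.
move=> s0; rewrite /embedding_exp/= inver gt_eqF// gt0_mulye ?lte_fin ?invr_gt0//.
by rewrite /conj_exp ltNge leey/= hoelder_conjugatey mule1.
Qed.

(* The exponent t = rs / (r - s) is the solution of 1 / t = 1 / s - 1 / r. *)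
Lemma embedding_exp_lt (r s : R) : 0 < s -> s < r ->
  embedding_exp r%:E s%:E = (r * s / (r - s))%:E.
Proof.
move=> s0 sr; rewrite /embedding_exp/= inver gt_eqF// -EFinM /conj_exp lte_fin.
have h : 1 < r / s by rewrite ltr_pdivlMr// mul1r.
rewrite ltNge (ltW h)/= /hoelder_conjugate/= eqe gt_eqF ?(lt_trans ltr01)//.
rewrite -EFinB inver subr_eq0 gt_eqF// -!EFinM; congr EFin.
have rs : r - s != 0 by rewrite subr_eq0 gt_eqF.
have sN0 : s != 0 by rewrite gt_eqF.
have -> : r / s - 1 = (r - s) / s by field.
by field; rewrite rs sN0.
Qed.

(** * Sufficiency of the condition on the multiplier *)

Context (I_neq0 : [set: I] !=set0).

Lemma unit_ball_bound p q w : (0 < p)%E -> (0 < q)%E -> (forall i, 0 < w i) ->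
  lspace (embedding_exp p q) (fun i => (w i)%:C) ->
  exists2 C : R, 0 <= C &
    forall x, (lnorm p x <= 1)%E -> (lnorm q (weight w x) <= C%:E)%E.
Proof.
move=> p0 q0 w0; have w_ge0 i : 0 <= w i by exact: ltW.
have [pq|qp] := leP p q.
  rewrite embedding_exp_le// => /(lspaceP I_neq0 _ _ lt0y)[C C0].
  move=> /lnormy_leP wC; exists C => // x; apply: unit_ball_bound_le => // i.
  by have := wC i; rewrite normc_real.
(* [q < p] rules out [q = +oo]. *)
case: q q0 qp => [s| |]// s0; last by rewrite ltNge leey.
rewrite lte_fin in s0.
case: p p0 => [r| |]// r0.
- rewrite lte_fin => sr; rewrite embedding_exp_lt//.
  have t0 : (0 < (r * s / (r - s))%:E)%E.
    by rewrite lte_fin divr_gt0 ?mulr_gt0 ?subr_gt0//; apply: lt_trans sr.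
  move=> /(lspaceP I_neq0 _ _ t0)[C C0 wC].
  exists ((C `^ (r * s / (r - s)) + 1) `^ s^-1); first exact: powR_ge0.
  by move=> x; exact: (unit_ball_bound_lt r s C w x s0 sr w0 C0 wC).
- move=> _; rewrite embedding_exp_y// => /(lspaceP I_neq0)[|C C0 wC].
    by rewrite lte_fin.
  by exists C => // x; apply: unit_ball_bound_y.
Qed.

(** * Finitely supported test sequences and necessity *)

Lemma normc_restrict (J : set I) (f : I -> R) i : (forall i, 0 <= f i) ->
  normc (if i \in J then (f i)%:C else 0%R) = if i \in J then f i else 0.
Proof. by move=> f0; case: ifP => _; rewrite -?[0]/(0%:C) normc_real. Qed.

Lemma lnorm_restrict (s : R) (J : set I) (f : I -> R) :
  0 < s -> finite_set J -> (forall i, 0 <= f i) ->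
  (lnorm s%:E (fun i => if i \in J then (f i)%:C else 0%R) <=
   ((\sum_(i \in J) f i `^ s) `^ s^-1)%:E)%E.
Proof.
move=> s0 finJ f0; apply/lnorm_leP; rewrite ?powR_ge0// => K finK.
rewrite powRVK ?gt_eqF//; last first.
  by apply: fsumr_ge0 => i _; exact: powR_ge0.
(* As [s] is nonzero, zero entries have zero power, and the sum over [K] reduces to the sum over the
   intersection of [K] and [J]. *)
under eq_fsbigr => i _.
  rewrite normc_restrict// (fun_if (fun a => a `^ s)) powR0 ?gt_eqF//.
  over.
rewrite -fsbig_mkcondr; apply: ler_fsum_subset => // i; exact: powR_ge0.
Qed.

Lemma l0space_restrict (J : set I) (f : I -> R) : finite_set J ->
  l0space (fun i => if i \in J then (f i)%:C else 0%R).
Proof.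
move=> finJ; apply: sub_finite_set finJ => i /=; case: ifP => [|_].
  by rewrite inE.
by rewrite eqxx.
Qed.

Lemma l0space_sub_lspace p x : (0 < p)%E -> l0space x -> lspace p x.
Proof.
move=> p0 fx; set S := [set i | x i != 0]%classic in fx.
have xS i : i \notin S -> normc (x i) = 0.
  rewrite notin_setE /S /= => /negP; rewrite negbK => /eqP ->.
  exact: ComplexField.Normc.normc0.
case: p p0 => [s| |]// s0.
- rewrite lte_fin in s0; apply/lspaceP => //.
  exists ((\sum_(i \in S) normc (x i) `^ s) `^ s^-1); first exact: powR_ge0.
  apply/lnorm_leP; rewrite ?powR_ge0// => K finK.
  rewrite powRVK ?gt_eqF//; last first.
    by apply: fsumr_ge0 => i _; exact: powR_ge0.
  apply: (@le_trans _ _ (\sum_(i \in K `&` S) normc (x i) `^ s)).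
    rewrite fsbig_mkcondr; apply: ler_fsum => // i _; case: ifPn => // /xS ->.
    by rewrite powR0 ?gt_eqF.
  by apply: ler_fsum_subset => // i; exact: powR_ge0.
(* The sum of the moduli over the support stands in for their maximum. *)
- apply/lspaceP => //; exists (\sum_(i \in S) normc (x i)).
    by apply: fsumr_ge0 => i _; exact: normc_ge0.
  apply/lnormy_leP => i; have [iS|/xS ->] := boolP (i \in S); last first.
    by apply: fsumr_ge0 => ? _; exact: normc_ge0.
  have -> : normc (x i) = \sum_(j \in [set i]) normc (x j) by rewrite fsbig_set1.
  apply: ler_fsum_subset => //.
    by move=> _ ->; rewrite -inE.
  by move=> ?; exact: normc_ge0.
Qed.

Lemma weight_restrict w (f : I -> R) (J : set I) i :
  weight w (fun i => if i \in J then (f i)%:C else 0%R) i =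
  if i \in J then (w i * f i)%:C else 0.
Proof. by rewrite /weight; case: ifP => _; rewrite ?mulr0// rmorphM. Qed.

(** Cancelling [S^(s/r)] leaves [S^((r-s)/r) <= C^s], which is then raised to the power
    [r / (r - s)]; [S = 0] is treated apart because of the cancellation. *)
Lemma powR_absorb (S C r s : R) : 0 <= S -> 0 <= C -> 0 < s -> s < r ->
  S <= (C * S `^ r^-1) `^ s -> S <= C `^ (r * s / (r - s)).
Proof.
move=> S0 C0 s0 sr; have r0 := lt_trans s0 sr.
have rs0 : 0 < r - s by rewrite subr_gt0.
move: S0; rewrite le_eqVlt => /predU1P[<- _|S0].
  exact: powR_ge0.
have -> : (C * S `^ r^-1) `^ s = C `^ s * S `^ (s / r).
  by rewrite powRM ?powR_ge0// -powRrM [r^-1 * s]mulrC.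
have {1}-> : S = S `^ ((r - s) / r) * S `^ (s / r).
  rewrite -powRD ?gt_eqF ?implybT// -mulrDl subrK mulfV ?gt_eqF// powRr1//.
  exact: ltW.
rewrite ler_pM2r ?powR_gt0// => h.
have e0 : 0 <= r / (r - s) by rewrite divr_ge0// ltW.
have := ge0_ler_powR e0 (powR_ge0 _ _) (powR_ge0 _ _) h.
rewrite /= -!powRrM mulrA divfK ?(gt_eqF r0)// divff ?(gt_eqF rs0)//.
rewrite powRr1 ?(ltW S0)//.
by rewrite [s * _]mulrCA mulrA.
Qed.

(** In every case the operator bound [C] itself bounds the norm of [w]. *)
Lemma multiplier_necessary p q (C : R) w : (0 < p)%E -> (0 < q)%E ->
  (forall i, 0 < w i) -> 0 <= C ->
  (forall x, l0space x -> (lnorm q (weight w x) <= C%:E * lnorm p x)%E) ->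
  lspace (embedding_exp p q) (fun i => (w i)%:C).
Proof.
move=> p0 q0 w0 C0 H.
have w_ge0 i : 0 <= w i by exact: ltW.
(* The hypothesis is specialised to [f] cut off to [J]; an upper bound [D] suffices in place of the
   exact norm. *)
have H' J f D : finite_set J -> 0 <= D ->
    (lnorm p (fun i => if i \in J then (f i)%:C else 0%R) <= D%:E)%E ->
    (lnorm q (fun i => if i \in J then (w i * f i)%:C else 0%R) <= (C * D)%:E)%E.
  move=> finJ D0 h; have := H _ (l0space_restrict J f finJ).
  have -> : weight w (fun i => if i \in J then (f i)%:C else 0%R) =
            (fun i => if i \in J then (w i * f i)%:C else 0%R).
    by apply/funext => i; exact: weight_restrict.
  by move/le_trans; apply; rewrite EFinM; apply: lee_wpmul2l; rewrite ?lee_fin.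
have [pq|qp] := leP p q.
  rewrite embedding_exp_le//; apply/lspaceP => //; exists C => //.
  apply/lnormy_leP => i; rewrite normc_real//.
  have one_p : (lnorm p (fun j => if j \in [set i] then 1%:C else 0%R) <= 1)%E.
    case: p p0 {H H' pq} => [r| |]// r0.
    - apply: le_trans (lnorm_restrict r _ _ r0 (finite_set1 i) _) _ => //.
      by rewrite fsbig_set1 !powR1.
    - apply/lnormy_leP => j; rewrite (normc_restrict _ (fun=> 1))//.
      by case: ifP.
  have := H' _ (fun=> 1) 1 (finite_set1 i) ler01 one_p.
  rewrite mulr1 => /(normc_le_lnorm q C _ i q0 C0).
  by rewrite mem_set// mulr1 normc_real.
case: q q0 qp H H' => [s| |]// s0; last by rewrite ltNge leey.
rewrite lte_fin in s0.
case: p p0 => [r| |]// r0 sr _ H'.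
- rewrite !lte_fin in r0 sr; rewrite embedding_exp_lt//.
  set t := r * s / (r - s).
  have rs0 : 0 < r - s by rewrite subr_gt0.
  have t0 : 0 < t by rewrite divr_gt0 ?mulr_gt0.
  apply/lspaceP => //; exists C => //; apply/lnorm_leP => // J finJ.
  under eq_fsbigr do rewrite normc_real//.
  set S := \sum_(_ \in _) _.
  have S0 : 0 <= S by apply: fsumr_ge0 => i _; exact: powR_ge0.
  (* With [f = w^(t/r)], both [f^r] and [(w f)^s] equal [w^t], the latter because [s (1 + t/r) = t].
     The same sum [S] therefore appears on both sides. *)
  have f0 i : 0 <= w i `^ (t / r) by exact: powR_ge0.
  have := lnorm_restrict r J _ r0 finJ f0.
  under eq_fsbigr do rewrite -powRrM divfK ?gt_eqF//.
  rewrite -/S => /(H' _ _ _ finJ (powR_ge0 _ _)).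
  move=> /(lnorm_leP _ _ _ s0 (mulr_ge0 C0 (powR_ge0 _ _)))/(_ J finJ).
  under eq_fsbigr => i iJ.
    rewrite iJ normc_real ?mulr_ge0//.
    have -> : (w i * w i `^ (t / r)) `^ s = w i `^ t.
      have wN0 : w i != 0 by rewrite gt_eqF.
      rewrite -{1}[w i]powRr1// -powRD ?wN0 ?implybT// -powRrM.
      congr powR; rewrite /t.
      have rN0 : r != 0 by rewrite gt_eqF.
      have rsN0 : r - s != 0 by rewrite gt_eqF.
      by field; rewrite rN0 rsN0.
    over.
  exact: powR_absorb.
- rewrite embedding_exp_y//; apply/lspaceP => //; exists C => //.
  apply/lnorm_leP => // J finJ.
  have one_y : (@lnorm R I +oo (fun j => if j \in J then 1%:C else 0%R) <= 1%:E)%E.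
    apply/lnormy_leP => j; rewrite (normc_restrict _ (fun=> 1))//.
    by case: ifP.
  have := H' J (fun=> 1) 1 finJ ler01 one_y.
  rewrite mulr1 => /(lnorm_leP _ _ _ s0 C0)/(_ J finJ); apply: le_trans.
  by apply: ler_fsum => // i iJ; rewrite mem_set// mulr1.
Qed.

End multiplier.

(** * Passage from a single multiplier to two weights *)

Theorem lemma5p1 (R : realType) (I : choiceType) (I_neq0 : [set: I] !=set0)
    (u v : I -> R) (u_gt0 : forall i, 0 < u i) (v_gt0 : forall i, 0 < v i)
    (p q : \bar R) (p_gt0 : (0 < p)%E) (q_gt0 : (0 < q)%E) :
  (bounded_map l0space (wlnorm v p) (wlspace u q) (wlnorm u q) (fun c => c) <->
   lspace (embedding_exp p q) (fun i => (u i / v i)%:C)) /\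
  (lspace (embedding_exp p q) (fun i => (u i / v i)%:C) ->
   embeds (wlspace v p) (wlnorm v p) (wlspace u q) (wlnorm u q)).
Proof.
have w_gt0 i : 0 < u i / v i by rewrite divr_gt0.
have vN0 i : (v i)%:C != 0 by rewrite (inj_eq (@complexI R)) gt_eqF.
have uE x : weight u x = weight (fun i => u i / v i) (weight v x).
  apply/funext => i; rewrite /weight mulrA -rmorphM/= divfK//.
  by rewrite gt_eqF.
have emb : lspace (embedding_exp p q) (fun i => (u i / v i)%:C) ->
    embeds (wlspace v p) (wlnorm v p) (wlspace u q) (wlnorm u q).
  move=> /(unit_ball_bound I_neq0 p q _ p_gt0 q_gt0 w_gt0)[C C0 HC].
  have H x : wlspace v p x -> (wlnorm u q x <= C%:E * wlnorm v p x)%E.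
    by rewrite /wlnorm uE; apply: lnorm_homogeneous_bound.
  split; last by exists C.
  move=> x xv; rewrite /wlspace /lspace /=; apply: le_lt_trans (H x xv) _.
  by apply: lte_mul_pinfty; rewrite ?lee_fin.
split=> //; split=> [[_ [C C0 HC]]|/emb [sub [C C0 HC]]].
- apply: (multiplier_necessary I_neq0 p q C) => // y fy.
  (* Division by [v] preserves finite supports, so each finitely supported [y] is [v x] for an
     admissible [x]. *)
  pose x i := (v i)%:C^-1 * y i.
  have yE : weight v x = y.
    by apply/funext => i; rewrite /weight /x mulrA mulfV// mul1r.
  rewrite -yE -uE; apply: HC; apply: sub_finite_set fy => i /=.
  by rewrite /x mulf_eq0 negb_or => /andP[].
(* Finitely supported sequences lie in the weighted space, so the bound is the restriction of the
   full embedding. *)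
- have l0v x : l0space x -> wlspace v p x.
    move=> fx; apply: l0space_sub_lspace => //; apply: sub_finite_set fx => i /=.
    by rewrite /weight mulf_eq0 negb_or => /andP[].
  split=> [x /l0v/sub//|]; exists C => // x /l0v; exact: HC.
Qed.
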